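(* Let $M$ be a matroid of rank $5$ and let $A$ and $B$ be any two bases of $M$. Then $A$ and $B$ have a full serial symmetric exchange of length at most $6$.
   Context: Matroids have a finite ground set. For a set $X$ and an element $x$, $X+x=X\cup\{x\}$ and $X-x=X\setminus\{x\}$. A serial symmetric basis-exchange of length $k$ between bases $A$ and $B$ is a sequence of pairs of bases $(A_0,B_0),(A_1,B_1),\dots,(A_k,B_k)$ of $M$ with $(A_0,B_0)=(A,B)$ such that for each $0\le i<k$ there are $x\in A_i$ and $y\in B_i$ with $A_{i+1}=A_i-x+y$ and $B_{i+1}=B_i-y+x$. It is full if it ends with all the elements exchanged, i.e. $(A_k,B_k)=(B,A)$. The length is the number $k$ of one-element exchanges performed; an element may be exchanged more than once. *)

(* Defs.v *)
(* Plain MathComp (finite sets over a finType). *)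
From mathcomp Require Import all_boot.

Set Implicit Arguments.
Unset Strict Implicit.
Unset Printing Implicit Defensive.

(* The (finite) ground set of the matroid is the whole type [T]. *)
Record matroid (T : finType) := Matroid {
  indep : pred {set T};
  indep0 : indep set0;
  indep_subset : forall I J : {set T}, J \subset I -> indep I -> indep J;
  indep_augment : forall I J : {set T}, indep I -> indep J -> #|I| < #|J| ->
    exists2 x, x \in J :\: I & indep (x |: I)
}.

Section SerialExchange.
Variables (T : finType) (M : matroid T).

Definition basis (A : {set T}) : bool := maxset (indep M) A.

Definition rank_of (X : {set T}) : nat :=
  \max_(I : {set T} | (I \subset X) && indep M I) #|I|.

Definition matroid_rank : nat := rank_of setT.

Definition basis_pair (p : {set T} * {set T}) : bool :=
  basis p.1 && basis p.2.

Definition exchange_step (p q : {set T} * {set T}) : bool :=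
  [exists x in p.1, exists y in p.2,
     (q.1 == y |: (p.1 :\ x)) && (q.2 == x |: (p.2 :\ y))].

(* [s] lists the pairs (A_1,B_1), ..., (A_k,B_k) following (A_0,B_0) = (A,B),
   so the length k of the exchange is [size s]. *)
Definition serial_exchange (A B : {set T}) (s : seq ({set T} * {set T})) :=
  all basis_pair ((A, B) :: s) && path exchange_step (A, B) s.

Definition full_serial_exchange (A B : {set T})
    (s : seq ({set T} * {set T})) :=
  serial_exchange A B s && (last (A, B) s == (B, A)).

End SerialExchange.

(* Main.v *)
(* Label A and B by 0..4 and 5..9, treating an element of both as a pair of
   parallel elements.  This pulls M back to a matroid on ten elements in which
   the states of an exchange sequence are the pairs (S, ~: S) of complementary
   bases.  Assuming that no full exchange of length at most 6 exists, a finite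
   case analysis, with basis exchange, symmetric exchange and relabellings
   inside A and inside B as its only rules, reaches a contradiction.  It has two
   parts: three consecutive exchanges that carry three elements of each side
   across can be completed, on the other end, within three more steps, with at
   most one of them lateral; and such a triple of exchanges always exists.  The
   analysis itself is a certificate, checked by computation. *)

From Stdlib Require Import BinPosDef.
Require Import Defs.
From mathcomp Require Import all_boot.

Set Implicit Arguments.
Unset Strict Implicit.
Unset Printing Implicit Defensive.

(** * Bases *)

Section Bases.
Variables (T : finType) (M : matroid T).
Implicit Types X Y I J : {set T}.

(** An inclusion-maximal independent set between [I] and [I :|: J] does it. Maximality is phrased by
    single elements, the form that [indep_card_leq] takes as hypothesis. *)
Lemma indep_extend I J : indep M I ->
  exists2 K : {set T}, I \subset K /\ K \subset I :|: J &
    indep M K /\ forall z, z \in I :|: J -> z \notin K -> ~~ indep M (z |: K).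
Proof.
move=> indI.
have [|K /maxsetP[/andP[indK KU] maxK] IK] :=
  @maxset_exists _ (fun K : {set T} => indep M K && (K \subset I :|: J)) I.
  by rewrite indI subsetUl.
exists K => //; split=> // z zU zK; apply: contra zK => indzK.
by rewrite -(maxK (z |: K)) ?setU11 ?subsetUr // indzK subUset sub1set zU.
Qed.

Lemma indep_card_leq I J : indep M I ->
  (forall z, z \in J -> z \notin I -> ~~ indep M (z |: I)) ->
  forall K : {set T}, K \subset J -> indep M K -> #|K| <= #|I|.
Proof.
move=> indI maxI K KJ indK; rewrite leqNgt; apply/negP => ltIK.
have [z /setDP[zK zI] indz] := indep_augment indI indK ltIK.
by have := maxI z (subsetP KJ z zK) zI; rewrite indz.
Qed.

Lemma basis_max X I : basis M X -> indep M I -> #|I| <= #|X|.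
Proof.
case/maxsetP=> indX maxX; apply: (@indep_card_leq X setT) => // z _ zX.
by apply: contra zX => indz; rewrite -(maxX _ indz) ?setU11 ?subsetUr.
Qed.

Lemma basis_card X : basis M X -> #|X| = matroid_rank M.
Proof.
move=> bX; apply/eqP; rewrite eqn_leq; apply/andP; split.
  by rewrite /matroid_rank /rank_of leq_bigmax_cond // subsetT (maxsetp bX).
by apply/bigmax_leqP => I /andP[_]; apply: basis_max.
Qed.

Lemma basisE A X : basis M A -> basis M X = indep M X && (#|X| == #|A|).
Proof.
move=> bA; have indA := maxsetp bA; apply/idP/andP => [bX | [indX /eqP cX]].
  have indX := maxsetp bX; split=> //.
  by rewrite eqn_leq (basis_max bA indX) (basis_max bX indA).
apply/maxsetP; split=> // Y indY XY; apply/eqP.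
by rewrite eq_sym eqEcard XY cX basis_max.
Qed.

(** One [y] has to serve both bases. It is sought on the fundamental circuit of [x] with respect to
    [Y], where any choice repairs [Y]; if none repaired [X], then [X :\ x] would span the circuit
    minus [x], and hence [x]. *)
Lemma basis_exchange X Y x : basis M X -> basis M Y -> x \in X -> x \notin Y ->
  exists y, [/\ y \in Y, y \notin X, basis M (y |: (X :\ x))
                & basis M (x |: (Y :\ y))].
Proof.
move=> bX bY xX xY.
have indX := maxsetp bX; have indY := maxsetp bY.
have cXY : #|X| = #|Y| by move: bX; rewrite (basisE _ bY) => /andP[_ /eqP].
have dep_xY : ~~ indep M (x |: Y).
  apply: contra xY => indxY; have /maxsetP[_ maxY] := bY.
  by rewrite -(maxY _ indxY) ?setU11 ?subsetUr.
(* K + x is the circuit of Y + x through x. *)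
have [K /minsetP[/andP[KY depK] minK] _] :
    {K | minset (fun K : {set T} => (K \subset Y) && ~~ indep M (x |: K)) K
       & K \subset Y}.
  by apply: minset_exists; rewrite subxx.
(* By minimality of [K], the set [x |: (K :\ y)] is independent. A maximal extension of it inside
   [x |: Y] has at least [#|Y|] elements and must avoid [y], which determines it. *)
have basisK y : y \in K -> basis M (x |: (Y :\ y)).
  move=> yK; have yY := subsetP KY y yK.
  have ind1 : indep M (x |: (K :\ y)).
    apply/negPn/negP => dep1; have /setP/(_ y) : K :\ y = K.
      apply: minK; last exact: subD1set.
      rewrite dep1 andbT; exact: subset_trans (subD1set K y) KY.
    by rewrite !inE eqxx yK.
  have [L [L1 L2] [indL maxL]] := indep_extend Y ind1.
  have U1 : x |: (K :\ y) :|: Y = x |: Y.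
    by rewrite -setUA (setUidPr (subset_trans (subD1set K y) KY)).
  rewrite U1 in L2 maxL.
  have yL : y \notin L.
    apply: contra depK => yL; apply: indep_subset indL.
    by rewrite -(setD1K yK) setUCA subUset sub1set yL.
  have LE : L \subset x |: (Y :\ y).
    apply/subsetP => z zL; have := subsetP L2 z zL; rewrite !inE.
    by case: (z =P y) => // zy; rewrite zy (negPf yL) in zL.
  have cL : #|Y| <= #|L|.
    by apply: indep_card_leq indL maxL _ (subsetUr _ _) indY.
  have cE : #|x |: (Y :\ y)| = #|Y|.
    by rewrite cardsU1 !inE (negPf xY) andbF (cardsD1 y Y) yY.
  have <- : L = x |: (Y :\ y) by apply/eqP; rewrite eqEcard LE cE.
  by rewrite (basisE _ bY) indL eqn_leq cL -cE subset_leq_card.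
(* Otherwise X - x spans K, hence also x. *)
have [/exists_inP[y yK /andP[yX ind1]] | noy] := boolP [exists y in K,
    (y \notin X) && indep M (y |: (X :\ x))].
  exists y; split=> //; [exact: (subsetP KY) | | exact: basisK].
  rewrite (basisE _ bX) ind1 cardsU1 !inE (negPf yX) andbF.
  by rewrite (cardsD1 x X) xX eqxx.
have ind0 : indep M (X :\ x) by apply: indep_subset indX; apply: subD1set.
have indK : indep M K by apply: indep_subset indY.
(* Here [X :\ x] is maximal independent in its union with [K], so [L] is smaller than [X].
   Augmenting [L] from [X] can only add [x], against the dependence of [x |: K]. *)
have [L [KL L2] [indL maxL]] := indep_extend (X :\ x) indK.
have cL : #|L| <= #|X :\ x|.
  apply: (indep_card_leq ind0 _ L2 indL) => z; rewrite !inE => zU zX.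
  have zK : z \in K by move: zU; rewrite (negPf zX) orbF.
  move: noy; rewrite negb_exists_in => /forall_inP/(_ z zK).
  rewrite negb_and negbK => /orP[zX'|//].
  rewrite zX' andbT negbK in zX; rewrite (eqP zX) in zK.
  by rewrite (subsetP KY x zK) in xY.
have ltL : #|L| < #|X| by rewrite (cardsD1 x X) xX ltnS.
have [z /setDP[zX zL] indz] := indep_augment indL indX ltL.
have [zx | zx] := eqVneq z x; last first.
  by have := maxL z _ zL; rewrite indz !inE zx zX orbT => /(_ isT).
case/negP: depK; apply: indep_subset indz.
by rewrite zx setUS.
Qed.

End Bases.

(** * Pulling a matroid back along a map *)

Section Pullback.
Variables (U T : finType) (f : U -> T) (M : matroid T).
Implicit Types X Y I J : {set U}.

(** Equality of the cardinals says that [f] is injective on [X], so two labels of the same element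
    become parallel. *)
Definition pull_indep : pred {set U} :=
  fun X => (#|f @: X| == #|X|) && indep M (f @: X).

Fact pull_indep0 : pull_indep set0.
Proof. by rewrite /pull_indep imset0 !cards0 eqxx indep0. Qed.

Fact pull_indep_subset I J : J \subset I -> pull_indep I -> pull_indep J.
Proof.
move=> JI /andP[/imset_injP injI indI].
rewrite /pull_indep (indep_subset (imsetS f JI) indI) andbT.
by apply/imset_injP => x y /(subsetP JI) xI /(subsetP JI) yI; apply: injI.
Qed.

Fact pull_indep_augment I J : pull_indep I -> pull_indep J -> #|I| < #|J| ->
  exists2 x, x \in J :\: I & pull_indep (x |: I).
Proof.
move=> /andP[/eqP cI indI] /andP[/eqP cJ indJ]; rewrite -cI -cJ => ltIJ.
have [_ /setDP[/imsetP[x xJ ->] xI] indx] := indep_augment indI indJ ltIJ.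
have xnI : x \notin I by apply: contra xI; apply: imset_f.
exists x; first by rewrite !inE xnI.
by rewrite /pull_indep imsetU1 indx !cardsU1 cI xI xnI eqxx.
Qed.

Definition pullback : matroid U :=
  Matroid pull_indep0 pull_indep_subset pull_indep_augment.

Variables A0 : {set U}.
Hypothesis fA0_basis : basis M (f @: A0).
Hypothesis fA0_card : #|f @: A0| = #|A0|.

(** The set [A0] shows that the two matroids have equal rank, so on both sides bases are the
    independent sets of that one cardinality. *)
Lemma pullback_basisE X :
  basis pullback X = (#|f @: X| == #|X|) && basis M (f @: X).
Proof.
have bA0 : basis pullback A0.
  apply/maxsetP; split=> [|Y /andP[/eqP cY indY] AY].
    by rewrite /= /pull_indep fA0_card eqxx (maxsetp fA0_basis).
  apply/eqP; rewrite eq_sym eqEcard AY -cY -fA0_card.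
  by have /maxsetP[_ maxA] := fA0_basis; rewrite (maxA _ indY (imsetS f AY)) leqnn.
rewrite (basisE _ bA0) (basisE _ fA0_basis) /= /pull_indep fA0_card -andbA.
by case: eqP => //= ->.
Qed.

Definition imset_pair (p : {set U} * {set U}) := (f @: p.1, f @: p.2).

Lemma pullback_basis_pair p :
  basis_pair pullback p -> basis_pair M (imset_pair p).
Proof.
by case/andP; rewrite /basis_pair !pullback_basisE => /andP[_ ->] /andP[_ ->].
Qed.

Lemma pullback_exchange_step p q : basis_pair pullback p ->
  exchange_step p q -> exchange_step (imset_pair p) (imset_pair q).
Proof.
case/andP; rewrite !pullback_basisE => /andP[/imset_injP inj1 _].
case/andP=> /imset_injP inj2 _ /exists_inP[x x1 /exists_inP[y y2]].
case/andP=> /eqP q1 /eqP q2.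
(* Injectivity on [X] is what makes removal commute with the image; bases of the pullback provide
   it. *)
have fD (X : {set U}) z : {in X &, injective f} -> z \in X ->
    f @: (X :\ z) = (f @: X) :\ f z.
  move=> injX zX; apply/setP=> t; rewrite !inE.
  apply/imsetP/andP => [[u /setD1P[uz uX] ->] | [tz /imsetP[u uX tE]]].
    by rewrite imset_f //; split=> //; apply: contra uz => /eqP/injX->.
  by exists u; rewrite // !inE uX andbT; apply: contra tz => /eqP<-; apply/eqP.
apply/exists_inP; exists (f x); first exact: imset_f.
apply/exists_inP; exists (f y); first exact: imset_f.
by rewrite /= q1 q2 !imsetU1 !fD // !eqxx.
Qed.

Lemma pullback_full_exchange X Y s :
  full_serial_exchange pullback X Y s ->
  full_serial_exchange M (f @: X) (f @: Y) (map imset_pair s).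
Proof.
case/andP=> /andP[/allP bs ps] /eqP ls.
rewrite /full_serial_exchange /serial_exchange.
rewrite -[(f @: X, f @: Y)]/(imset_pair (X, Y)) last_map ls eqxx andbT.
rewrite -map_cons all_map; apply/andP; split.
  by apply/allP => p /bs; apply: pullback_basis_pair.
elim: s (X, Y) bs ps {ls} => //= q s IHs p bs /andP[pq qs].
rewrite pullback_exchange_step ?bs ?mem_head //=; apply: IHs => // r rs.
by apply: bs; rewrite inE rs orbT.
Qed.

End Pullback.

(** * Refutation checker *)

(* (s, false, m) says that the set with characteristic sequence m is (s = true)
   or is not (s = false) a basis; (s, true, m) says the same of the conjunction
   of this property for m and for its complement. *)
Definition lit := (bool * bool * bitseq)%type.

(** Least significant digit first, so that bit i of a numeral in the certificate stands for element
    i. *)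
Fixpoint pos_bits (p : positive) : bitseq :=
  match p with
  | xH => [:: true]
  | xO q => false :: pos_bits q
  | xI q => true :: pos_bits q
  end.

(** Padding to length 10 gives each set a unique sequence, since literals are compared
    syntactically. *)
Definition mask_of (p : positive) : bitseq := mkseq (nth false (pos_bits p)) 10.

Definition cpl (m : bitseq) : bitseq := mkseq (fun i => ~~ nth false m i) 10.

Definition swap (m : bitseq) (x y : nat) : bitseq :=
  set_nth false (set_nth false m x false) y true.

Definition maskA : bitseq := mask_of 31.

Definition blit (s : bool) (m : bitseq) : lit := (s, false, m).

(* Of the two names m and cpl m of a complementary pair, the one containing 0
   is kept. *)
Definition glit (s : bool) (m : bitseq) : lit :=
  (s, true, if head false m then m else cpl m).

Definition bas (p : positive) : lit := blit true (mask_of p).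
Definition nonbas (p : positive) : lit := blit false (mask_of p).
Definition pair (p : positive) : lit := glit true (mask_of p).
Definition nonpair (p : positive) : lit := glit false (mask_of p).

Definition neg (l : lit) : lit := (~~ l.1.1, l.1.2, l.2).

(** Only one-step inferences between a complementary pair and its two members. A missed inference
    merely leaves a case open, so only soundness matters. *)
Definition entails (f : seq lit) (l : lit) : bool :=
  let: (s, k, m) := l in
  (l \in f) ||
  match s, k with
  | true, false => glit true m \in f
  | false, false => (glit false m \in f) && (blit true (cpl m) \in f)
  | true, true => (blit true m \in f) && (blit true (cpl m) \in f)
  | false, true => (blit false m \in f) || (blit false (cpl m) \in f)
  end.

(* The image of i is the hexadecimal digit of weight 16 ^ i. *)
Definition perm_of (p : positive) : seq nat :=
  [seq foldr (fun (b : bool) k => b + k.*2) 0 d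
     | d <- reshape (nseq 10 4) (pos_bits p)].

(** Relabellings that preserve the blocks 0..4 and 5..9 turn counterexamples into
    counterexamples. *)
Definition block_perm (p : seq nat) : bool :=
  perm_eq p (iota 0 10) && all (fun i => i < 5) (take 5 p).

(** This is the direct image of the set: [index j p] is the preimage of [j]. *)
Definition act (p : seq nat) (m : bitseq) : bitseq :=
  mkseq (fun j => nth false m (index j p)) 10.

Definition act_lit (p : seq nat) (l : lit) : lit :=
  if l.1.2 then glit l.1.1 (act p l.2) else blit l.1.1 (act p l.2).

(* Each rule names a disjunction of literals that holds in every counterexample
   to the theorem: exchange of an element of the first set (Exch modifies the
   first basis and CoExch the second one), symmetric exchange between a basis
   and its complement, failure of one of the states of a short exchange path,
   failure of the k-th pattern refuted so far after a relabelling, and excluded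
   middle. *)
Inductive rule :=
| Exch of positive & positive & nat
| CoExch of positive & positive & nat
| SymExch of positive & nat
| Path of seq positive
| Inst of nat & positive
| Split of lit.

(** Positions found in [iota 0 10] are the elements themselves, and 10 means that none was found.
    The last test ensures that nothing else changes. *)
Definition step (m m' : bitseq) : bool :=
  let x := find (fun i => nth false m i && ~~ nth false m' i) (iota 0 10) in
  let y := find (fun i => ~~ nth false m i && nth false m' i) (iota 0 10) in
  [&& x < 10, y < 10, nth false m x, ~~ nth false m y & m' == swap m x y].

Definition clause (pats : seq (seq lit)) (r : rule) : seq lit :=
  (* the clause of an ill-formed rule *)
  let taut := [:: glit true maskA] in
  match r with
  | Exch p q x => let m := mask_of p in let n := mask_of q in
      if [&& x < 10, nth false m x & ~~ nth false n x] then
        [:: blit false m, blit false n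
          & [seq blit true (swap m x y)
              | y <- iota 0 10 & nth false n y && ~~ nth false m y]]
      else taut
  | CoExch p q x => let m := mask_of p in let n := mask_of q in
      if [&& x < 10, nth false m x & ~~ nth false n x] then
        [:: blit false m, blit false n
          & [seq blit true (swap n y x)
              | y <- iota 0 10 & nth false n y && ~~ nth false m y]]
      else taut
  | SymExch p x => let m := mask_of p in
      if (x < 10) && nth false m x then
        glit false m :: [seq glit true (swap m x y)
                          | y <- iota 0 10 & ~~ nth false m y]
      else taut
  | Path ps => let ms := map mask_of ps in
      (* Five intermediate states amount to six exchanges, the last one leading to the complement of
         A. *)
      if (size ps <= 5) && path step maskA (rcons ms (cpl maskA)) then
        map (glit false) ms
      else taut
  | Inst k p => let s := perm_of p in
      if (k < size pats) && block_perm s then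
        [seq neg (act_lit s l) | l <- nth [::] pats k]
      else taut
  | Split l => [:: l; neg l]
  end.

(* pend lists the open cases, each given by the literals assumed in it; a rule
   splits the first one according to the literals of its clause. *)
Fixpoint check (pats : seq (seq lit)) (pend : seq (seq lit)) (rs : seq rule) :=
  match pend, rs with
  | [::], _ => true
  | f :: pend', r :: rs' =>
      (* Literals contradicting the case are dropped; if none of the clause survives, the case is
         closed. *)
      check pats ([seq l :: f | l <- clause pats r & ~~ entails f (neg l)]
                    ++ pend') rs'
  | _, [::] => false
  end.

(** Each pattern is refuted with the help of the earlier ones, starting from the fact that A and its
    complement are bases. Reaching the empty conjunction means that no counterexample exists. *)
Fixpoint verify (pats : seq (seq lit)) (cert : seq (seq lit * seq rule)) :=
  match cert with
  | [::] => [::] \in pats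
  | (pat, rs) :: cert' =>
      check pats [:: rcons pat (glit true maskA)] rs
        && verify (rcons pats pat) cert'
  end.

(** * Bit sequences as subsets of a ten-element set *)

Definition supp (m : bitseq) : {set 'I_10} := [set i : 'I_10 | nth false m i].

Lemma supp_mkseq (g : nat -> bool) : supp (mkseq g 10) = [set i : 'I_10 | g i].
Proof. by apply/setP=> i; rewrite !inE nth_mkseq. Qed.

Lemma supp_cpl m : supp (cpl m) = ~: supp m.
Proof. by apply/setP=> i; rewrite supp_mkseq !inE. Qed.

Lemma in_maskA (i : 'I_10) : (i \in supp maskA) = (i < 5).
Proof. by rewrite inE; case: i; do 10!case=> //. Qed.

Lemma card_maskA : #|supp maskA| = 5.
Proof.
rewrite -sum1_card (eq_bigl _ _ in_maskA) big_mkcond /=.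
by rewrite !big_ord_recl big_ord0.
Qed.

Lemma supp_swap m (x y : 'I_10) :
  supp (swap m x y) = y |: (supp m :\ x).
Proof.
apply/setP=> i; rewrite !inE /swap !nth_set_nth /= !nth_set_nth /=.
by rewrite -!(inj_eq val_inj) /=; case: (val i == y); case: (val i == x).
Qed.

Definition block_map (p : seq nat) (i : 'I_10) : 'I_10 := inord (nth 0 p i).

Section BlockPermutation.
Variable p : seq nat.
Hypothesis bp : block_perm p.

Let perm_p : perm_eq p (iota 0 10).
Proof. by have [] := andP bp. Qed.

Let size_p : size p = 10.
Proof. by rewrite (perm_size perm_p) size_iota. Qed.

Let uniq_p : uniq p.
Proof. by rewrite (perm_uniq perm_p) iota_uniq. Qed.

Let mem_p j : (j \in p) = (j < 10).
Proof. by rewrite (perm_mem perm_p) mem_iota. Qed.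

Let block_mapE (i : 'I_10) : block_map p i = nth 0 p i :> nat.
Proof. by rewrite inordK // -mem_p mem_nth ?size_p. Qed.

Lemma block_map_inj : injective (block_map p).
Proof.
move=> i j /(congr1 val)/eqP; rewrite /= !block_mapE nth_uniq ?size_p //.
by move=> /eqP/val_inj.
Qed.

Lemma supp_act m : supp (act p m) = block_map p @: supp m.
Proof.
apply/setP=> j; rewrite supp_mkseq inE; apply/idP/imsetP => [mj | [i mi ->]].
  have ij : index (val j) p < 10.
    by have := index_mem (val j) p; rewrite mem_p ltn_ord size_p.
  exists (Ordinal ij); first by rewrite inE.
  by apply: val_inj; rewrite /= block_mapE nth_index ?mem_p.
by rewrite inE in mi; rewrite block_mapE index_uniq ?size_p.
Qed.

Lemma block_map_A : block_map p @: supp maskA = supp maskA.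
Proof.
have /allP p5 : all (fun i => i < 5) (take 5 p) by have [] := andP bp.
apply/eqP; rewrite eqEcard card_imset ?leqnn ?andbT; last exact: block_map_inj.
apply/subsetP=> _ /imsetP[i iA ->]; rewrite !in_maskA in iA *.
by rewrite block_mapE p5 // -(nth_take 0 iA) mem_nth // size_take size_p.
Qed.

Lemma block_map_setC (X : {set 'I_10}) :
  block_map p @: (~: X) = ~: (block_map p @: X).
Proof.
have inj := block_map_inj; have [g fg gf] := injF_bij inj.
by rewrite !(can2_imset_pre _ fg gf) preimsetC.
Qed.

End BlockPermutation.

(** * Labelled counterexamples and soundness of the checker *)

Definition model (N : matroid 'I_10) : Prop :=
  let A := supp maskA in
  [/\ basis N A, basis N (~: A) &
      forall s, full_serial_exchange N A (~: A) s -> 6 < size s].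

Definition holds (N : matroid 'I_10) (l : lit) : bool :=
  let: (s, k, m) := l in
  (basis N (supp m) && (k ==> basis N (~: supp m))) == s.

(** All models are quantified over because a relabelled use of the pattern applies it to a different
    matroid. *)
Definition refuted (pat : seq lit) : Prop :=
  forall N, model N -> ~~ all (holds N) pat.

Section Soundness.
Variable N : matroid 'I_10.
Hypothesis modN : model N.

Lemma holds_neg l : holds N (neg l) = ~~ holds N l.
Proof. by case: l => [[[] k] m] /=; case: (_ && _). Qed.

Lemma holds_blit s m : holds N (blit s m) = (basis N (supp m) == s).
Proof. by rewrite /= andbT. Qed.

Lemma holds_glit s m :
  holds N (glit s m) = (basis_pair N (supp m, ~: supp m) == s).
Proof.
rewrite /glit /basis_pair /=; case: (head _ _) => //=.
by rewrite supp_cpl setCK andbC.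
Qed.

Lemma entails_holds f l : all (holds N) f -> entails f l -> holds N l.
Proof.
move=> /allP hf; case: l => [[s k] m]; rewrite /entails.
case/orP=> [/hf //|]; case: s; case: k => /=.
- case/andP=> /hf + /hf; rewrite !holds_blit supp_cpl.
  by move=> /eqP-> /eqP->.
- by move/hf; rewrite holds_glit => /eqP/andP[/= -> _].
- case/orP=> /hf; rewrite holds_blit ?supp_cpl => /eqP->; rewrite ?andbF //.
- case/andP=> /hf + /hf; rewrite holds_blit holds_glit supp_cpl /basis_pair /=.
  by move=> + /eqP bC; rewrite bC !andbT.
Qed.

Lemma step_swap m m' : step m m' -> exists x y : 'I_10,
  [/\ x \in supp m, y \notin supp m & supp m' = y |: (supp m :\ x)].
Proof.
rewrite /step; case/and5P=> x10 y10 mx my /eqP->.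
exists (Ordinal x10), (Ordinal y10); rewrite !inE; split=> //.
by rewrite -supp_swap.
Qed.

(** Hence symmetric exchanges preserve complementarity, and one mask describes both sides of a
    state. *)
Lemma setC_swap (X : {set 'I_10}) x y : x \in X -> y \notin X ->
  ~: (y |: (X :\ x)) = x |: (~: X :\ y).
Proof.
move=> xX yX; apply/setP=> i; rewrite !inE.
have [->|_] := eqVneq i x; last by rewrite orFb negb_or.
by rewrite orbF; apply: contraNneq yX => <-.
Qed.

Definition mask_pair m := (supp m, ~: supp m).

Lemma step_exchange m m' : step m m' ->
  exchange_step (mask_pair m) (mask_pair m').
Proof.
case/step_swap=> x [y [mx my m'E]].
apply/exists_inP; exists x => //; apply/exists_inP; exists y; first by rewrite inE.
by rewrite /= m'E setC_swap // !eqxx.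
Qed.

Lemma path_exchange m s : path step m s ->
  path (@exchange_step _) (mask_pair m) (map mask_pair s).
Proof.
by elim: s m => //= m' s IHs m /andP[/step_exchange-> /IHs].
Qed.

Lemma clause_holds pats r : (forall pat, pat \in pats -> refuted pat) ->
  has (holds N) (clause pats r).
Proof.
move=> ref; have [bA bC noex] := modN.
have taut : has (holds N) [:: glit true maskA].
  by rewrite has_seq1 holds_glit /basis_pair bA bC.
have exch (m n : bitseq) (x : nat) (x10 : x < 10) : nth false m x ->
    ~~ nth false n x -> basis N (supp m) -> basis N (supp n) ->
    exists y : 'I_10, [/\ nth false n y, ~~ nth false m y,
      basis N (supp (swap m x y)) & basis N (supp (swap n y x))].
  move=> mx nx bm bn.
  have [||y []] := @basis_exchange _ N _ _ (Ordinal x10) bm bn; rewrite ?inE //.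
  move=> ny my b1 b2; exists y; split=> //.
    by rewrite (supp_swap m (Ordinal x10)).
  by rewrite (supp_swap n y (Ordinal x10)).
have mem10 (y : 'I_10) (P : pred nat) (F : nat -> lit) : P y -> holds N (F y) ->
    has (holds N) [seq F i | i <- iota 0 10 & P i].
  move=> Py Fy; apply/hasP; exists (F y) => //; apply: map_f.
  by rewrite mem_filter Py mem_iota ltn_ord.
(* Abstracting the list of elements keeps the disjunctions indexed by it from being expanded. *)
rewrite /clause; move: (iota 0 10) mem10 => I mem10.
case: r => [p q x|p q x|p x|ps|k p|l] /=.
- case: and3P => // -[x10 mx nx].
  rewrite -![has _ (_ :: _)]/(_ || _) !holds_blit.
  case bm: (basis N _) => //; case bn: (basis N _) => //=.
  have [y [ny my b1 _]] := exch _ _ _ x10 mx nx bm bn.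
  by apply: (mem10 y _ _ (introT andP (conj ny my))); rewrite holds_blit b1.
- case: and3P => // -[x10 mx nx].
  rewrite -![has _ (_ :: _)]/(_ || _) !holds_blit.
  case bm: (basis N _) => //; case bn: (basis N _) => //=.
  have [y [ny my _ b2]] := exch _ _ _ x10 mx nx bm bn.
  by apply: (mem10 y _ _ (introT andP (conj ny my))); rewrite holds_blit b2.
- case: andP => // -[x10 mx].
  rewrite -[has _ (_ :: _)]/(_ || _) holds_glit.
  case bp: (basis_pair N _) => //=; have /andP[/= bm bc] := bp.
  (* Basis exchange is applied to the set and its complement; the two new bases are again
     complementary. *)
  have nx : ~~ nth false (cpl (mask_of p)) x by rewrite nth_mkseq // negbK.
  rewrite -supp_cpl in bc.
  have [y [ny my b1 b2]] := exch _ _ _ x10 mx nx bm bc.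
  apply: (mem10 y _ _ my); rewrite holds_glit /basis_pair b1 /=.
  rewrite (supp_swap _ (Ordinal x10)) setC_swap ?inE // -supp_cpl.
  by rewrite -(supp_swap _ y (Ordinal x10)) b2.
- case: andP => // -[sz pth]; set ms := map _ _ in pth *.
  rewrite has_map; apply/negPn/negP => /hasPn nh.
  (* If all intermediate states were pairs of bases, appending the final state would give a full
     exchange too short for a model. *)
  have bms m : m \in ms -> basis_pair N (mask_pair m).
    move/nh; rewrite -[X in ~~ X]/(holds N (glit false m)) holds_glit.
    by rewrite eqbF_neg negbK.
  have /noex : full_serial_exchange N (supp maskA) (~: supp maskA)
      (map mask_pair (rcons ms (cpl maskA))).
    have endE : mask_pair (cpl maskA) = (~: supp maskA, supp maskA).
      by rewrite /mask_pair supp_cpl setCK.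
    rewrite /full_serial_exchange /serial_exchange.
    rewrite -[(supp maskA, ~: supp maskA)]/(mask_pair maskA) last_map last_rcons.
    rewrite -map_cons all_map endE eqxx andbT; apply/andP; split.
      apply/allP => m; rewrite inE mem_rcons inE => /or3P[/eqP->|/eqP->|/bms//].
        by rewrite /= /basis_pair bA bC.
      by rewrite /= endE /basis_pair bA bC.
    exact: path_exchange.
  by rewrite size_map size_rcons size_map ltnS leqNgt ltnS sz.
- case: andP => // -[kp bp]; have := ref _ (mem_nth [::] kp).
  have fA := block_map_A bp.
  (* The pullback along the relabelling is again a model, and a literal holds in it exactly when its
     relabelling holds in [N]; so some literal of the refuted pattern fails there. *)
  set f := block_map _ in fA; set N' := pullback f N.
  have bA' : basis N (f @: supp maskA) by rewrite fA.
  have cA' : #|f @: supp maskA| = #|supp maskA| by rewrite fA.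
  have fC (X : {set 'I_10}) : f @: (~: X) = ~: (f @: X).
    exact: block_map_setC.
  have cf (X : {set 'I_10}) : #|f @: X| = #|X|.
    by rewrite card_imset //; apply: block_map_inj.
  have bE X : basis N' X = basis N (f @: X).
    by rewrite (pullback_basisE bA' cA') cf eqxx.
  have modN' : model N'.
    split; rewrite ?bE ?fC ?fA //.
    move=> s /(pullback_full_exchange bA' cA'); rewrite fC fA => /noex.
    by rewrite size_map.
  move=> /(_ _ modN'); rewrite has_map -has_predC => /hasP[l ls nl].
  apply/hasP; exists l => //.
  rewrite -[preim _ _ l]/(holds N (neg (act_lit (perm_of p) l))) holds_neg.
  apply: contra nl.
  case: l {ls} => [[s []] m].
    rewrite -[act_lit _ _]/(glit s (act (perm_of p) m)) holds_glit supp_act //.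
    by rewrite /basis_pair /= !bE fC.
  rewrite -[act_lit _ _]/(blit s (act (perm_of p) m)) holds_blit supp_act //.
  by rewrite /= andbT bE.
rewrite -[X in _ || (X || _)]/(holds N (neg l)).
by rewrite holds_neg orbA orbN.
Qed.

(** If the split case held in the model, so would a literal of the clause. That literal cannot have
    been dropped, so the case extended by it is still pending, against the induction hypothesis. *)
Lemma check_sound pats pend rs : (forall pat, pat \in pats -> refuted pat) ->
  check pats pend rs -> forall f, f \in pend -> ~~ all (holds N) f.
Proof.
move=> ref; elim: rs pend => [|r rs IHrs] [|f pend] //= /IHrs chk g.
rewrite inE => /predU1P[->|gp]; last by apply: chk; rewrite mem_cat gp orbT.
apply/negP => hf; have /hasP[l lr hl] := clause_holds r ref.
have/negP[] : ~~ all (holds N) (l :: f).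
  apply: chk; rewrite mem_cat map_f // mem_filter lr andbT.
  by apply/negP => /(@entails_holds _ (neg l) hf); rewrite holds_neg hl.
by rewrite /= hl.
Qed.

End Soundness.

Lemma verify_sound pats cert : (forall pat, pat \in pats -> refuted pat) ->
  verify pats cert -> forall N, ~ model N.
Proof.
elim: cert pats => [|[pat rs] cert IHcert] pats ref /=.
  (* The empty pattern holds vacuously in every model. *)
  by move=> /ref r N /r.
case/andP=> chk; apply: IHcert => p; rewrite mem_rcons inE => /predU1P[->|/ref//].
move=> N modN; have := check_sound modN ref chk (mem_head _ _).
rewrite all_rcons holds_glit /basis_pair.
by have [bA bC _] := modN; rewrite bA bC.
Qed.

(** * Reduction to ten labelled elements *)

Section FiveElementBases.
Variables (T : finType) (M : matroid T) (A B : {set T}).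
Hypotheses (basisA : basis M A) (basisB : basis M B) (cardA : #|A| = 5).

(** Sequences of at most six states form finite types, so the alternative is decided by a boolean
    search, without classical axioms. *)
Lemma short_exchange_dec :
  (exists s, full_serial_exchange M A B s /\ size s <= 6) \/
  (forall s, full_serial_exchange M A B s -> 6 < size s).
Proof.
case: (boolP [exists k : 'I_7, exists s : k.-tuple ({set T} * {set T}),
                full_serial_exchange M A B s]) => [|nex].
  case/existsP=> k /existsP[s ex_s]; left; exists s.
  by rewrite size_tuple -ltnS.
right=> s ex_s; rewrite ltnNge; apply: contra nex => les.
apply/existsP; exists (Ordinal (les : size s < 7)).
by apply/existsP; exists (in_tuple s).
Qed.

Lemma labelled_model : (forall s, full_serial_exchange M A B s -> 6 < size s) ->
  exists N, model N.
Proof.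
move=> noex; have cardB : #|B| = 5.
  by rewrite (basis_card basisB) -(basis_card basisA).
have [x0 _] : exists x, x \in A by apply/set0Pn; rewrite -card_gt0 cardA.
(* An element common to A and B receives two labels; [x0] only serves as default for [nth]. *)
pose f (i : 'I_10) := if i < 5 then nth x0 (enum A) i else nth x0 (enum B) (i - 5).
have fA : f @: supp maskA = A.
  apply/setP=> x; apply/imsetP/idP => [[i] | xA].
    by rewrite in_maskA /f => i5 ->; rewrite i5 -mem_enum mem_nth // -cardE cardA.
  have ix : index x (enum A) < 5 by rewrite -cardA cardE index_mem mem_enum.
  exists (widen_ord (isT : 5 <= 10) (Ordinal ix)); first by rewrite in_maskA.
  by rewrite /f /= ix nth_index ?mem_enum.
have fB : f @: (~: supp maskA) = B.
  apply/setP=> x; apply/imsetP/idP => [[i] | xB].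
    rewrite in_setC in_maskA /f => /[dup] i5 /negPf-> ->.
    rewrite -leqNgt in i5.
    by rewrite -mem_enum mem_nth // -cardE cardB ltn_subLR // ltn_ord.
  have ix : index x (enum B) < 5 by rewrite -cardB cardE index_mem mem_enum.
  exists (rshift 5 (Ordinal ix)); first by rewrite in_setC in_maskA -leqNgt leq_addr.
  by rewrite /f /= addKn nth_index ?mem_enum.
have cA : #|f @: supp maskA| = #|supp maskA| by rewrite fA cardA card_maskA.
have bA : basis M (f @: supp maskA) by rewrite fA.
exists (pullback f M); split; rewrite ?(pullback_basisE bA cA) ?cA ?fA ?fB ?eqxx //.
  (* The second block has 10 - 5 = 5 labels, as many as B has elements. *)
  rewrite basisB cardB andbT -(eqn_add2l #|supp maskA|) cardsC.
  by rewrite card_maskA card_ord.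
move=> s /(pullback_full_exchange bA cA); rewrite fA fB => /noex.
by rewrite size_map.
Qed.

End FiveElementBases.

(** * The case analysis *)

Local Open Scope positive_scope.

(* The third pattern is the reverse of three consecutive exchanges; the later
   ones lead to the existence of such a triple. *)
Definition cert : seq (seq lit * seq rule) := [::
   ([:: pair 961; pair 899; pair 403; bas 283; pair 539],
    [:: Path [:: 62; 124; 620; 740]; Path [:: 62; 124; 620; 744];
    Path [:: 62; 124; 620; 868]; Path [:: 62; 124; 620; 872]; CoExch 992 620 7;
    CoExch 620 992 2; CoExch 31 403 2; Path [:: 539; 659; 403; 899; 961];
    Path [:: 62; 124; 372; 484]; CoExch 403 539 7; CoExch 868 124 8;
    CoExch 395 539 7; Exch 143 539 2; Split (bas 157);
    Path [:: 539; 787; 403; 899; 961]; Path [:: 62; 124; 244; 484];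
    CoExch 484 744 2; Split (nonbas 110); Exch 899 283 7; Split (nonbas 109);
    CoExch 376 868 3; CoExch 488 868 3; CoExch 403 775 4; Exch 203 539 6;
    Split (nonbas 79); Split (nonbas 55); CoExch 151 307 2; SymExch 31 3;
    Path [:: 87; 339; 403; 899; 961]; SymExch 403 7; Exch 779 55 3;
    CoExch 779 206 0; CoExch 779 205 1; Exch 236 31 5; Exch 220 372 3;
    Path [:: 62; 124; 220; 468; 484]; Path [:: 62; 124; 220; 460; 484];
    SymExch 539 3; CoExch 539 675 3; Path [:: 62; 316; 428; 484]; SymExch 899 8;
    CoExch 620 79 5; CoExch 868 109 8; CoExch 62 236 1; CoExch 174 539 7;
    Path [:: 62; 124; 109; 357; 484]; Path [:: 62; 124; 117; 357; 484];
    SymExch 124 3; Exch 794 899 3; Path [:: 62; 124; 118; 230; 484];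
    SymExch 484 8; CoExch 868 110 8; Exch 899 283 7; Split (nonbas 118);
    SymExch 124 3; Exch 117 230 0; Path [:: 62; 124; 117; 229; 484];
    SymExch 484 8; Exch 157 539 2; CoExch 157 899 3;
    Path [:: 62; 124; 118; 358; 484]; CoExch 185 151 3; Exch 409 62 8;
    SymExch 992 7; Path [:: 158; 410; 403; 899; 961]; SymExch 620 3]);
   ([:: pair 961; pair 899; pair 403; bas 283],
    [:: Path [:: 62; 124; 620; 740]; Path [:: 62; 124; 620; 744];
    Path [:: 62; 124; 620; 868]; CoExch 992 620 7; Inst 0 0x9876543210;
    Path [:: 62; 124; 620; 872]; CoExch 620 992 2; CoExch 31 403 2;
    Inst 0 0x9786542310; Split (nonbas 55); CoExch 151 307 2; SymExch 31 3;
    Path [:: 87; 339; 403; 899; 961]; Path [:: 87; 211; 403; 899; 961];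
    SymExch 403 7; Exch 936 620 7; CoExch 31 787 2; Exch 151 91 2;
    Exch 364 744 2; SymExch 31 2; Path [:: 59; 179; 403; 899; 961];
    SymExch 403 8; Exch 403 55 7; Split (bas 684); Split (nonbas 87);
    SymExch 31 3; Path [:: 55; 307; 403; 899; 961]; Split (nonbas 59);
    CoExch 283 179 3; SymExch 31 2; Path [:: 91; 339; 403; 899; 961];
    Path [:: 91; 211; 403; 899; 961]; SymExch 403 8; Exch 31 659 2;
    CoExch 236 992 2; SymExch 403 7; CoExch 403 59 7;
    Path [:: 55; 179; 403; 899; 961]; Exch 968 620 7; Exch 403 87 7;
    Split (nonbas 91); SymExch 31 2; Path [:: 59; 307; 403; 899; 961];
    CoExch 964 620 7; CoExch 684 992 2; Path [:: 91; 339; 403; 899; 961];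
    CoExch 692 744 2; Exch 932 124 8; SymExch 31 2;
    Path [:: 59; 307; 403; 899; 961]; CoExch 964 620 7]);
   ([:: pair 961; pair 899; pair 403],
    (* [Inst] counts patterns from 0, and [0x9876543210] is the identity. Exchanging 2 out of A
       against 403 brings in 7 or 8; the second relabelling interchanges these and fixes the three
       pairs. *)
    [:: Inst 1 0x9876543210; Exch 31 403 2; Inst 1 0x9786543210]);
   ([:: pair 835; pair 779; bas 158; bas 484; bas 173],
    [:: Inst 2 0x6985734210; Inst 2 0x6987534210; Inst 2 0x6987534201;
    Inst 2 0x6985734201; Inst 2 0x6759831042; Inst 2 0x6758931042;
    CoExch 992 835 5; CoExch 835 992 0; CoExch 31 188 0; Exch 173 31 5;
    Split (pair 47); Exch 835 976 0; Exch 47 188 0; Inst 2 0x9867532014;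
    Inst 2 0x6987503214; Inst 2 0x6987532014; Inst 2 0x8967532014;
    SymExch 244 4; Inst 2 0x6987532104; Inst 2 0x6987502134; SymExch 173 3;
    CoExch 961 817 6; CoExch 779 880 0; Inst 2 0x6985704213; Exch 866 793 1;
    Exch 181 31 5; Inst 2 0x6759831024; Inst 2 0x6758931024; Exch 31 779 2;
    Exch 779 31 8; Exch 992 244 8; CoExch 779 143 8; Split (pair 91);
    Inst 2 0x9758631042; Inst 2 0x9758641032; Inst 2 0x8759631042;
    Inst 2 0x8759641032; Exch 932 244 8; Exch 779 91 8; CoExch 835 283 6;
    CoExch 779 79 8; CoExch 835 395 6; Exch 484 188 6; Exch 451 866 0;
    CoExch 932 744 2; SymExch 31 4; CoExch 752 482 4; Exch 535 91 2;
    Exch 992 173 8; CoExch 880 242 8; CoExch 737 835 5; CoExch 737 880 0;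
    CoExch 339 611 4; CoExch 625 31 9; Exch 188 541 5; Exch 173 541 5;
    CoExch 668 932 3; Inst 2 0x8657903241; Split (nonpair 143); SymExch 31 4;
    Exch 866 817 1; Exch 376 992 3; Exch 372 992 2; Inst 2 0x9758631024;
    Inst 2 0x8759621034; Inst 2 0x8759631024; CoExch 944 484 4; Exch 944 835 7;
    Exch 283 79 4; SymExch 779 8; CoExch 684 752 2; CoExch 835 527 6;
    Exch 31 555 2; Exch 468 752 2; Exch 59 188 0; CoExch 818 472 5;
    CoExch 944 488 4; CoExch 558 61 1; CoExch 302 61 1; CoExch 158 299 2;
    Exch 61 527 4; Exch 976 186 9; Exch 557 186 0; CoExch 466 961 1;
    SymExch 779 9; Inst 2 0x6875934210; Inst 2 0x6875934201; SymExch 992 9;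
    CoExch 880 484 4; Split (pair 155); CoExch 868 752 2; Exch 779 155 8;
    Inst 2 0x6958731024; Inst 2 0x9658731024; Inst 2 0x6859731024;
    SymExch 188 7; SymExch 31 2; Exch 835 964 0; Exch 59 188 0;
    CoExch 961 880 0; Split (pair 167); Inst 2 0x6985712034;
    Inst 2 0x9865702134; Inst 2 0x8965702134; Inst 2 0x6985702134;
    SymExch 244 4; Inst 2 0x6985713204; Inst 2 0x6985703214; SymExch 167 0;
    Exch 47 158 0; Inst 2 0x6987514203; CoExch 866 976 1; CoExch 167 59 2;
    Exch 992 856 5; Split (pair 171); Inst 2 0x9867503142; Inst 2 0x8967503142;
    Inst 2 0x6985731024; Inst 2 0x6985713024; Inst 2 0x8965731024;
    Inst 2 0x9865731024; Inst 2 0x6985703124; SymExch 171 3;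
    Inst 2 0x6987514032; Inst 2 0x6987504132; SymExch 244 2;
    Inst 2 0x6759821043; Inst 2 0x6758921043; Inst 2 0x6987514302;
    SymExch 248 4; SymExch 171 0; Inst 2 0x6985713204; Split (pair 173);
    Inst 2 0x8965732014; Inst 2 0x9865732014; Inst 2 0x6985732014;
    Inst 2 0x6985703214; SymExch 173 3; Exch 961 850 0; SymExch 244 4;
    Inst 2 0x6987504213; Exch 961 842 0; CoExch 230 61 1; SymExch 880 5;
    CoExch 880 838 4; Inst 2 0x6985723104; Inst 2 0x9865723104;
    Inst 2 0x8965723104; SymExch 174 2; CoExch 143 186 0; CoExch 992 837 5]);
   ([:: pair 835; pair 779; bas 158; bas 484],
    [:: Inst 2 0x6985734210; Inst 2 0x6987534201; Inst 2 0x6985734201;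
    Inst 2 0x6759831042; Inst 2 0x6758931042; CoExch 992 835 5; Exch 31 779 2;
    Exch 992 244 8; Inst 3 0x9876543210; CoExch 205 188 0; Exch 143 244 1;
    Inst 3 0x8976523410; CoExch 217 188 0; Exch 155 244 1; SymExch 835 0;
    Inst 2 0x6985704213; SymExch 992 7]);
   (* Up to relabelling, this is any exchange between a state with two and one with three elements
      of A. The sets 484 and 740 are interchanged by swapping 8 and 9, and 158 and 62 by swapping 5
      and 7, so [bas 158] and [bas 484] may be assumed. *)
   ([:: pair 835; pair 779],
    [:: Split (bas 158); Inst 4 0x9876543210; CoExch 244 992 2;
    Inst 4 0x8976543210; Exch 31 188 0; Inst 4 0x9856743210; CoExch 244 992 2;
    Inst 4 0x8956743210]);
   ([:: pair 835; pair 849; pair 841; pair 611; pair 613; nonbas 398],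
    [:: Inst 5 0x9678543210; Inst 5 0x9678534210; Inst 5 0x9678532140;
    Inst 5 0x9678523140; Exch 412 174 4; Exch 410 174 4; Exch 849 31 8;
    CoExch 835 601 1; Exch 428 182 3]);
   ([:: pair 835; pair 849; pair 837; pair 841; pair 611; pair 613; nonbas 406],
    [:: Inst 5 0x9678543210; Inst 5 0x9678523140; Inst 5 0x9678543120;
    Inst 6 0x9876543210; Exch 412 182 3; Exch 410 182 3; CoExch 398 436 1;
    Exch 841 31 8]);
   ([:: pair 835; pair 849; pair 837; pair 841; pair 611; pair 613; nonbas 617],
    [:: Inst 5 0x9678543210; Inst 5 0x9678534210; Inst 5 0x9678523140;
    Inst 5 0x9678543120; CoExch 841 611 3; CoExch 841 613 3; Exch 440 182 3;
    CoExch 992 182 8; CoExch 992 412 5; CoExch 849 587 4]);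
   ([:: pair 835; pair 849; pair 837; pair 841; pair 611; pair 613; pair 803; nonbas 206],
    [:: Inst 5 0x8679543210; Inst 5 0x9876534210; Inst 5 0x8679534210;
    Inst 5 0x8679542310; Inst 5 0x9876532140; Inst 5 0x9876523140;
    Inst 5 0x8679543120; Inst 5 0x9586734210; Inst 5 0x9586734120;
    Inst 6 0x9876543210; Inst 7 0x9876543210; Inst 8 0x9876543210;
    Inst 5 0x9678534210; Inst 5 0x9678532140; Inst 5 0x9678523140;
    Split (nonbas 625); CoExch 849 611 4; CoExch 849 613 4; CoExch 849 617 4;
    CoExch 992 174 8; Inst 5 0x9586724130; Inst 5 0x8579634210; Exch 220 174 4;
    Exch 220 398 4; SymExch 849 6; SymExch 625 6; SymExch 220 4;
    CoExch 835 913 1; CoExch 818 835 4; CoExch 595 818 0; CoExch 659 818 0;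
    CoExch 31 803 4; CoExch 818 689 1; CoExch 535 818 0; CoExch 539 818 0;
    CoExch 31 689 1; CoExch 179 850 0; CoExch 899 31 9; CoExch 818 527 4;
    Exch 220 590 4; CoExch 841 334 0; CoExch 837 334 0; Exch 542 110 4;
    Exch 558 188 1; CoExch 992 572 7]);
   ([:: pair 835; pair 849; pair 837; pair 841; pair 611; pair 613; pair 803; nonbas 214],
    [:: Inst 5 0x9876543210; Inst 5 0x9876523140; Inst 5 0x9876543120;
    Inst 5 0x9586743210; Inst 7 0x9876543210; Inst 8 0x9876543210;
    Inst 5 0x9586724130; Inst 5 0x8579643210; Inst 9 0x9876543210;
    Exch 220 182 3; Exch 220 406 3; CoExch 206 244 1; Exch 206 406 3;
    SymExch 841 6; SymExch 220 3; Exch 905 31 7; CoExch 905 787 3;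
    CoExch 837 283 9; CoExch 837 539 8; CoExch 651 810 0; Exch 665 810 7;
    CoExch 781 155 9; CoExch 31 410 0]);
   ([:: pair 835; pair 849; pair 837; pair 841; pair 611; pair 613; pair 803; nonbas 218],
    [:: Inst 5 0x9586742310; Inst 5 0x9586743120; Inst 5 0x9586734120;
    Inst 9 0x9876543210; Inst 10 0x9876543210; Exch 220 410 2; CoExch 206 472 1;
    Exch 214 458 2; SymExch 613 6; Exch 677 31 7]);
   ([:: pair 835; pair 849; pair 837; pair 841; pair 611; pair 613; pair 803; nonbas 805],
    [:: Inst 5 0x9876542310; Inst 5 0x9876532140; Inst 5 0x9876543120;
    Inst 5 0x6589743210; Inst 5 0x6589734210; Inst 5 0x9586742310;
    Inst 5 0x9586743120; Inst 5 0x9586734120; Inst 6 0x9876543210;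
    Inst 7 0x9876543210; Inst 8 0x9876543210; Inst 5 0x6589724130;
    Inst 5 0x8579642310; CoExch 837 803 2; SymExch 837 6; SymExch 613 6;
    SymExch 220 2; Exch 122 217 1; Exch 806 677 1; Exch 932 406 5;
    Exch 932 398 5; CoExch 611 121 1]);
   ([:: pair 835; pair 849; pair 837; pair 841; pair 611; pair 613; pair 803; nonbas 809],
    [:: Inst 5 0x9876543210; Inst 5 0x9876523140; Inst 5 0x9876543120;
    Inst 5 0x9586743210; Inst 5 0x9586743120; Inst 8 0x9876543210;
    Inst 12 0x9876543210; CoExch 841 803 3; CoExch 617 803 3; CoExch 841 805 3;
    CoExch 617 805 3; SymExch 841 6; CoExch 496 182 6; Exch 220 992 3;
    Exch 220 484 3; CoExch 724 482 4; Exch 992 118 9]);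
   ([:: pair 835; pair 849; pair 837; pair 841; pair 611; pair 613; pair 803; nonbas 817],
    [:: Inst 5 0x9876534210; Inst 5 0x9876532140; Inst 5 0x9876523140;
    Inst 12 0x9876543210; Inst 13 0x9876543210; CoExch 849 803 4;
    CoExch 849 805 4; CoExch 849 809 4; CoExch 992 174 6]);
   ([:: pair 835; pair 849; pair 837; pair 841; pair 611; pair 613; pair 929; pair 689],
    [:: Inst 5 0x8679543120; Inst 5 0x9586734210; Inst 2 0x9758613240;
    Inst 2 0x5978613240; SymExch 334 1; Inst 2 0x9758634210;
    Inst 5 0x8679543210; Inst 5 0x9586734120; Inst 2 0x9758623140;
    Inst 2 0x5978623140; SymExch 334 2; Inst 2 0x9758624310; Split (bas 167);
    Exch 841 348 0; Exch 841 346 0; CoExch 689 182 0; CoExch 675 174 0;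
    CoExch 675 182 0; Exch 837 348 0]);
   ([:: pair 835; pair 849; pair 837; pair 841; pair 611; pair 613; pair 803],
    [:: Inst 5 0x9678543210; Inst 5 0x8679543210; Inst 5 0x9678534210;
    Inst 5 0x8679534210; Inst 5 0x9678542310; Inst 5 0x8679542310;
    Inst 5 0x8679532140; Inst 5 0x8679523140; Inst 5 0x8679543120;
    Inst 5 0x6589743210; Inst 5 0x6589734210; Inst 5 0x6589742310;
    Inst 5 0x6589743120; Inst 5 0x6589734120; Inst 6 0x9876543210;
    Inst 7 0x9876543210; Inst 8 0x9876543210; Inst 5 0x9678532140;
    Inst 5 0x9678523140; Split (nonbas 625); CoExch 849 611 4; CoExch 849 613 4;
    CoExch 849 617 4; CoExch 992 174 8; Inst 5 0x6589724130;
    Inst 5 0x8579643210; Inst 5 0x8579634210; Inst 5 0x8579642310;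
    Inst 9 0x9876543210; Inst 10 0x9876543210; Inst 11 0x9876543210;
    Inst 12 0x9876543210; Inst 13 0x9876543210; Inst 14 0x9876543210;
    Inst 5 0x8579643120; Inst 5 0x8579634120; Inst 5 0x8579624130;
    Split (pair 355); Split (bas 94); Inst 5 0x9876542310; Inst 5 0x9586742310;
    Inst 14 0x8679524310; Inst 11 0x8679543210; Split (pair 929);
    Inst 15 0x9876543210; Inst 15 0x9576843210; Inst 15 0x9876534210;
    Inst 15 0x8976534210; Inst 15 0x9576834210; Inst 15 0x9876524310;
    Inst 15 0x9576824310; Inst 15 0x9876514320; SymExch 929 8;
    Inst 15 0x9578614320; Inst 15 0x9576814320; SymExch 929 5;
    Inst 15 0x9875631420; Inst 15 0x9875621430; Inst 15 0x9875643210;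
    Split (pair 87); SymExch 936 8; SymExch 936 5; Split (bas 103);
    Exch 936 410 5; Exch 936 412 5; CoExch 625 55 6; CoExch 55 357 1;
    CoExch 87 355 2; Exch 666 744 1; SymExch 968 6; SymExch 488 6;
    SymExch 744 6; SymExch 31 3; Split (pair 647); SymExch 376 5; SymExch 376 8;
    SymExch 376 6; SymExch 167 7; SymExch 391 7; SymExch 199 7; Split (bas 103);
    Exch 944 410 5; Exch 944 412 5; CoExch 617 110 0; CoExch 872 47 6;
    CoExch 47 355 2; CoExch 79 355 2; Exch 666 752 1; SymExch 632 9;
    SymExch 856 9; SymExch 824 9; SymExch 79 3; SymExch 151 4;
    Inst 5 0x9876543210; Inst 5 0x9586743210; Inst 14 0x8679534210;
    Inst 11 0x8679542310; SymExch 271 3; SymExch 47 3; Split (pair 651);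
    SymExch 372 6; SymExch 372 5; SymExch 372 8; SymExch 203 7; SymExch 171 7;
    SymExch 395 7; Split (bas 107); Exch 932 406 5; Exch 932 412 5;
    Exch 625 31 9; Exch 117 59 2; CoExch 59 361 1; CoExch 91 355 3;
    Exch 662 740 1; SymExch 820 9; SymExch 91 4; Inst 5 0x9876523140;
    Inst 5 0x9586724130; SymExch 628 9; SymExch 852 9; SymExch 283 4;
    SymExch 59 4; Split (pair 665); SymExch 358 6; SymExch 358 5; SymExch 358 8;
    SymExch 217 7; SymExch 185 7; SymExch 409 7; Inst 14 0x8679543210;
    Split (bas 109); Exch 930 662 5; Exch 930 666 5; CoExch 369 61 6;
    CoExch 61 357 3; CoExch 93 357 3; Exch 662 738 2; SymExch 806 9;
    SymExch 93 2; Inst 15 0x8976543210; Inst 15 0x8976524310;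
    Inst 15 0x8976514320; SymExch 929 9; Inst 15 0x6978514320;
    Inst 15 0x8579614320; Inst 15 0x6978543210; Inst 15 0x8975643210;
    SymExch 527 3; SymExch 659 4; SymExch 539 4; SymExch 211 4; SymExch 653 2;
    SymExch 661 2; SymExch 541 2; SymExch 355 0; SymExch 213 2; Split (bas 331);
    SymExch 143 2; Split (nonbas 79); CoExch 206 331 2; CoExch 31 331 2;
    CoExch 331 143 6; CoExch 331 94 0; CoExch 662 737 4; CoExch 188 737 4;
    Exch 868 188 6; Exch 271 812 0; Split (bas 87); Exch 992 186 6;
    CoExch 872 930 3; CoExch 87 220 0; CoExch 79 214 0; CoExch 880 920 5;
    Exch 817 936 0; CoExch 866 696 8; Exch 872 186 6; Exch 872 188 6;
    Exch 666 992 1; Exch 752 412 6; Exch 728 625 3; Exch 217 151 3;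
    Exch 721 206 9; SymExch 403 4; SymExch 143 2; SymExch 614 9; SymExch 405 2;
    Split (bas 79); CoExch 79 361 1; CoExch 835 79 8; CoExch 79 841 1;
    CoExch 841 79 8; Exch 412 805 3; Exch 406 868 1; CoExch 880 186 9;
    Exch 570 107 4; Inst 14 0x8679543210; Inst 11 0x8679532410;
    Inst 15 0x6978531420; Inst 15 0x8975631420; SymExch 205 2; Split (bas 87);
    CoExch 87 206 0; CoExch 872 944 3; Exch 872 186 6; Exch 872 188 6;
    Exch 817 186 0; Exch 217 151 3; CoExch 961 220 0; CoExch 837 94 0;
    CoExch 835 94 0; Exch 103 31 5; CoExch 91 355 3; Exch 91 143 4;
    CoExch 91 841 1; CoExch 151 107 2; CoExch 47 355 2; Exch 992 182 6;
    CoExch 295 944 2; Exch 992 805 6; Exch 992 809 6; Split (bas 103);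
    Exch 666 936 1; Exch 410 936 1; Exch 103 849 5; CoExch 87 837 1;
    Exch 992 817 6; Split (bas 107); CoExch 613 107 2; Exch 944 406 5;
    CoExch 611 109 1; Exch 611 31 9; Exch 617 31 9; Exch 932 398 5;
    CoExch 206 31 6; CoExch 218 79 4; CoExch 214 31 6; Split (nonbas 103);
    CoExch 611 79 5; CoExch 613 79 5; CoExch 613 87 5; Exch 920 406 3;
    CoExch 992 410 9; Split (bas 107); Exch 914 412 1; CoExch 992 412 9;
    CoExch 992 406 9; CoExch 992 410 9; CoExch 817 107 4; Exch 59 87 3;
    CoExch 625 55 6; CoExch 611 91 5; CoExch 617 79 5; CoExch 992 668 8;
    Exch 916 410 2; SymExch 835 9; SymExch 611 9; SymExch 803 9;
    Inst 15 0x8579614320; Split (pair 357); Inst 14 0x8679514320;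
    Inst 11 0x8679543120; SymExch 837 9; SymExch 805 9; Split (pair 361);
    Inst 14 0x8679514230; Inst 11 0x8679542130; SymExch 659 0; Split (pair 369);
    Inst 14 0x8679513240; Inst 11 0x8679532140; SymExch 849 9; SymExch 817 9;
    SymExch 651 0; SymExch 647 0; SymExch 865 9; Inst 15 0x8965743210;
    Inst 15 0x8956743210; SymExch 31 0; Inst 15 0x9578614320;
    Inst 2 0x5769824310; Inst 2 0x5769834210; Inst 2 0x5769843210;
    SymExch 314 1; SymExch 310 1; SymExch 302 1; SymExch 737 5]);
   ([:: pair 835; pair 849; pair 837; pair 841; pair 611; pair 613],
    [:: Inst 5 0x9876543210; Inst 5 0x8679543210; Inst 5 0x9876534210;
    Inst 5 0x8679534210; Inst 5 0x9876542310; Inst 5 0x8679542310;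
    Inst 5 0x9876532140; Inst 5 0x9876543120; Inst 16 0x9876543210;
    SymExch 835 6; Inst 16 0x6879543210; SymExch 835 9; Split (pair 805);
    Inst 11 0x9876543120; Inst 12 0x9876543120; SymExch 837 6;
    Inst 16 0x8659743210]);
   ([:: pair 835; pair 849; pair 837; pair 841],
    [:: Inst 5 0x9678543210; Inst 5 0x9678534210; Inst 5 0x9678542310;
    Inst 5 0x9678532140; Inst 5 0x9678523140; Inst 5 0x9678543120;
    Split (pair 611); Inst 17 0x9876543210; SymExch 837 8; Inst 17 0x9876542310;
    SymExch 841 8; Inst 17 0x9856741320; SymExch 835 8; Inst 17 0x9856743210;
    SymExch 837 8; Inst 17 0x9856742310; SymExch 841 8; Inst 17 0x9876541320]);
   ([:: pair 835; pair 849; pair 837; nonbas 122],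
    [:: Inst 5 0x9876543210; Inst 5 0x9678543210; Inst 5 0x8679543210;
    Inst 5 0x8679534210; Inst 5 0x9876542310; Inst 5 0x9876532140;
    Inst 5 0x8679532140; Inst 5 0x8679523140; Inst 5 0x9876543120;
    Inst 18 0x9876543210; SymExch 188 3; Inst 5 0x7598634120;
    Inst 5 0x7598632140; Inst 5 0x7596832140; SymExch 837 6;
    Inst 5 0x8579634120; SymExch 842 8; CoExch 618 186 6; CoExch 849 805 4;
    CoExch 405 849 2; CoExch 405 817 2; Exch 654 618 2; SymExch 849 9;
    Inst 2 0x6875923104; Inst 2 0x6875923140; SymExch 558 5]);
   ([:: pair 835; pair 849; pair 837],
    [:: Inst 5 0x9876543210; Inst 5 0x9678543210; Inst 5 0x8679543210;
    Inst 5 0x9876523140; Inst 5 0x9678523140; Inst 5 0x8679523140;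
    Inst 5 0x9876543120; Inst 5 0x9678543120; Inst 5 0x8679543120;
    Inst 18 0x9876543210; SymExch 188 3; SymExch 174 3; SymExch 186 3;
    Inst 5 0x7598634210; Inst 5 0x7596834210; Inst 5 0x7589634120;
    Inst 5 0x7589632140; Inst 5 0x9876534210; Inst 5 0x9876542310;
    Inst 5 0x8679542310; Inst 5 0x7598634120; Inst 5 0x7598632140;
    Inst 19 0x9876543210; Split (nonbas 124); Exch 122 188 1; SymExch 835 6;
    Inst 5 0x8579643210; Inst 5 0x8579634210; Inst 5 0x8579642310;
    CoExch 837 803 2; SymExch 803 9; SymExch 844 8; SymExch 856 8;
    CoExch 620 188 6; CoExch 391 805 1; Exch 835 391 6; CoExch 391 837 1;
    CoExch 899 789 1; Exch 849 391 6; Exch 668 752 2; CoExch 913 248 9;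
    Inst 5 0x9678534210; Inst 5 0x9678542310; Inst 5 0x7589634210;
    Split (nonbas 316); Inst 5 0x7596834120; SymExch 835 8; Split (nonbas 199);
    SymExch 856 6; Inst 5 0x6589742310; Inst 5 0x9678532140;
    Inst 5 0x7596832140; Split (nonbas 314); SymExch 837 8; Inst 5 0x6589734120;
    Exch 410 122 7; SymExch 842 6; Exch 167 613 1; CoExch 410 810 4;
    Exch 314 188 1; Inst 5 0x9586742310; CoExch 837 611 2; Exch 613 199 5;
    SymExch 856 9; Inst 2 0x6857912034; Inst 2 0x6857912043; SymExch 647 7;
    Inst 5 0x8679532140; Inst 5 0x7596834120; Split (nonbas 346);
    Inst 5 0x9678532140; Split (nonbas 314); SymExch 837 8; Exch 410 122 7;
    CoExch 122 856 1; CoExch 314 856 1; Exch 167 357 1; Exch 167 992 1;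
    CoExch 677 453 5; SymExch 837 9; Inst 5 0x8679534210; Split (bas 348);
    CoExch 992 167 9; Exch 929 167 8; Exch 737 167 6; Exch 689 167 4;
    CoExch 992 179 9; CoExch 167 992 0; CoExch 849 346 0; CoExch 849 348 0;
    CoExch 841 348 0; Exch 744 174 6; Exch 936 174 8; CoExch 992 617 7;
    CoExch 992 713 5; Exch 992 809 6; CoExch 992 905 5; Exch 601 481 4;
    Exch 793 481 4; CoExch 31 849 3; CoExch 124 346 2; CoExch 844 346 2;
    CoExch 316 856 2; Exch 94 844 1; CoExch 992 181 9; CoExch 675 692 0;
    Exch 167 992 2]);
   (* The set 188 is the complement of 835. The nine instances of pattern 5 leave only lateral
      exchanges for its elements 2, 3 and 4 of A. *)
   ([:: pair 835],
    [:: Inst 5 0x9876534210; Inst 5 0x9678534210; Inst 5 0x8679534210;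
    Inst 5 0x9876542310; Inst 5 0x9678542310; Inst 5 0x8679542310;
    Inst 5 0x9876543210; Inst 5 0x9678543210; Inst 5 0x8679543210;
    Split (pair 849); Inst 20 0x9876543210; SymExch 188 2; Inst 20 0x9876542310;
    SymExch 188 3; Inst 20 0x9876534201; SymExch 188 4; Inst 20 0x9876543201;
    SymExch 188 2; Inst 20 0x9876524310; SymExch 188 3; Inst 20 0x9876542301]);
   (* Relabellings act transitively on the sets with two elements of A and three of B, so pattern 21
      now excludes every such set, and likewise its complement, from the states. *)
   ([::],
    [:: Inst 21 0x9786543210; Inst 21 0x9875643210; Inst 21 0x9785643210;
    Inst 21 0x8795643210; Inst 21 0x9685743210; Inst 21 0x8695743210;
    Inst 21 0x7695843210; Inst 21 0x9786543120; Inst 21 0x8796543120;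
    Inst 21 0x9867543120; Inst 21 0x9875643120; Inst 21 0x9785643120;
    Inst 21 0x8795643120; Inst 21 0x9685743120; Inst 21 0x8695743120;
    Inst 21 0x7695843120; Inst 21 0x9876542130; Inst 21 0x8796542130;
    Inst 21 0x9867542130; Inst 21 0x9875642130; Inst 21 0x9785642130;
    Inst 21 0x8795642130; Inst 21 0x9685742130; Inst 21 0x8695742130;
    Inst 21 0x7695842130; Inst 21 0x8796532140; Inst 21 0x9875632140;
    Inst 21 0x8795632140; Inst 21 0x8695732140; Inst 21 0x7695832140;
    Inst 21 0x9876543021; Inst 21 0x9786543021; Inst 21 0x8796543021;
    Inst 21 0x9867543021; Inst 21 0x9875643021; SymExch 775 0;
    Inst 21 0x9785643021; SymExch 647 0; Inst 21 0x9685743021; SymExch 583 0;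
    SymExch 551 0; SymExch 824 9; SymExch 920 9; SymExch 856 9; SymExch 728 9;
    SymExch 793 0; Inst 21 0x9876542031; SymExch 173 3; SymExch 171 1;
    Inst 21 0x9786542031; SymExch 307 1; SymExch 299 3; Inst 21 0x8796542031;
    SymExch 557 3; SymExch 555 1; Inst 21 0x9867542031; SymExch 109 3;
    SymExch 107 1; Inst 21 0x9875642031; SymExch 779 0; SymExch 781 2;
    Inst 21 0x9876543120; Inst 21 0x9785632140; Inst 21 0x9685732140;
    SymExch 179 1; SymExch 563 1; SymExch 115 1; Split (nonbas 59);
    SymExch 932 5; SymExch 740 5; SymExch 484 5; SymExch 868 5; SymExch 31 2;
    Inst 21 0x9876543210; Inst 21 0x8796543210; Inst 21 0x9876532140;
    Inst 21 0x9786532140; Inst 21 0x9867532140; SymExch 696 9; SymExch 211 1;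
    SymExch 205 3; SymExch 203 3; Inst 21 0x9785642031; SymExch 618 6;
    SymExch 339 1; SymExch 333 3; SymExch 436 5; SymExch 331 3; SymExch 434 8;
    Split (nonbas 79); SymExch 496 6; SymExch 752 6; SymExch 976 6;
    SymExch 880 6; SymExch 31 4; Inst 21 0x9786542130; SymExch 665 0;
    SymExch 651 0; SymExch 653 2; Split (nonbas 496); SymExch 944 9;
    SymExch 752 9; SymExch 976 9; SymExch 880 9; SymExch 31 4;
    Split (nonbas 527); SymExch 944 9; SymExch 752 9; SymExch 976 9;
    SymExch 880 9; SymExch 31 4; SymExch 527 0; SymExch 496 8; SymExch 496 5;
    SymExch 527 3; SymExch 481 7; SymExch 47 2; Split (bas 837); SymExch 496 6;
    SymExch 79 0; Split (bas 122); SymExch 158 2; Exch 155 122 0;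
    CoExch 837 929 2; Exch 59 752 0; Exch 158 570 2; CoExch 837 481 2;
    SymExch 496 7; Split (bas 709); Inst 21 0x9768543210; SymExch 659 4;
    SymExch 661 2; SymExch 234 7; SymExch 787 4; SymExch 488 8;
    Split (nonbas 286); SymExch 279 0; SymExch 496 6; SymExch 79 0;
    Split (bas 122); SymExch 628 9; SymExch 271 2; Exch 283 122 0;
    CoExch 709 929 2; Exch 59 880 0; Exch 286 570 2; CoExch 709 481 2;
    CoExch 535 964 0; CoExch 613 964 0; CoExch 79 964 0; CoExch 901 865 2;
    CoExch 79 805 6; Exch 59 602 0; Exch 542 752 2])].

Local Close Scope positive_scope.

Lemma cert_verified : verify [::] cert.
Proof. by vm_compute. Qed.

Theorem theorem4p1 (T : finType) (M : matroid T) (A B : {set T})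
    (rankM : matroid_rank M = 5) (basisA : basis M A) (basisB : basis M B) :
  exists s : seq ({set T} * {set T}),
    full_serial_exchange M A B s /\ size s <= 6.
Proof.
have cardA : #|A| = 5 by rewrite (basis_card basisA).
have [//|noex] := short_exchange_dec M A B.
have [N modN] := labelled_model basisA basisB cardA noex.
have ref0 pat : pat \in [::] -> refuted pat by [].
by have [] := verify_sound ref0 cert_verified modN.
Qed.
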